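(* Let $n\ge 2$. The set $\mathscr{F}_{n,3}$ is in bijection with the set $\{0,1\}^{n-2}=(\mathbb{Z}/2\mathbb{Z})^{n-2}$ of binary strings of length $n-2$; in particular $|\mathscr{F}_{n,3}|=2^{n-2}$.
   Context: DAGs have vertex set $[n+1]$ and a finite multiset of directed edges $(i,j)$ with $i<j$ (parallel edges allowed, counted with multiplicity), and are identified with their edge multisets. $\mathscr{F}_{n,3}$ is the set of such DAGs with out-degree sequence $(3,2,\dots,2,0)$ and in-degree sequence $(0,2,\dots,2,3)$. *)

(* Defs.v *)
From mathcomp Require Import all_boot all_algebra finmap multiset.
From mathcomp Require Import all_classical.

Set Implicit Arguments.
Unset Strict Implicit.
Unset Printing Implicit Defensive.

Local Open Scope classical_set_scope.

(* A DAG on the vertex set [n+1] is identified with its edge multiset; the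
   vertex k of [n+1] is the ordinal k - 1, and E (i, j) is the multiplicity of
   the edge (i, j). *)
Definition edge_multiset (n : nat) := {mset ('I_n.+1 * 'I_n.+1)}%mset.

Definition is_dag (n : nat) (E : edge_multiset n) : Prop :=
  forall i j : 'I_n.+1, (i, j) \in E -> i < j.

Definition outdeg (n : nat) (E : edge_multiset n) (i : 'I_n.+1) : nat :=
  \sum_(j < n.+1) E (i, j).

Definition indeg (n : nat) (E : edge_multiset n) (j : 'I_n.+1) : nat :=
  \sum_(i < n.+1) E (i, j).

Definition outdeg_seq (n : nat) (E : edge_multiset n) : seq nat :=
  [seq outdeg E i | i <- enum 'I_n.+1].

Definition indeg_seq (n : nat) (E : edge_multiset n) : seq nat :=
  [seq indeg E i | i <- enum 'I_n.+1].

Definition F3 (n : nat) : set (edge_multiset n) :=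
  [set E | [/\ is_dag E,
               outdeg_seq E = 3 :: rcons (nseq n.-1 2) 0 &
               indeg_seq E = 0 :: rcons (nseq n.-1 2) 3]].
Arguments F3 : clear implicits.

(* Main.v *)
Require Import Defs.
From mathcomp Require Import all_boot all_algebra finmap multiset.
From mathcomp Require Import all_classical.
From mathcomp Require Import zify.

Local Open Scope classical_set_scope.
Local Open Scope card_scope.

(* Scan the vertices 0, ..., n in order and record the sources of the edges
   that cross the cut between k and k+1.  There are always three of them, and
   they form a multiset {a, k, k} where a < k (for k > 0): vertex k+1 < n absorbs
   two of the three and emits two new ones.  It absorbs either {k, k}, keeping
   the survivor a, or {a, k}, making k the survivor; vertex 1 has no choice
   because it sees {0, 0, 0}, and vertex n absorbs everything.  So a DAG in F3
   is a sequence of independent binary choices at the vertices 2, ..., n-1, and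
   the choice at k+1 is read off the multiplicity, 2 or 1, of (k, k+1). *)

Fixpoint survivor (b : nat -> bool) (k : nat) : nat :=
  if k is k'.+1 then if b k'.+1 then k' else survivor b k' else 0.

(** [b j] is true when vertex [j] absorbs the survivor and one copy of [j - 1], false when it
    absorbs both copies of [j - 1]. The [else] branch is the last vertex, which takes all three
    edges. *)
Definition mult (n : nat) (b : nat -> bool) (i j : nat) : nat :=
  if j is k.+1 then
    if k.+1 < n then (2 - b k.+1) * (i == k) + b k.+1 * (i == survivor b k)
    else 2 * (i == k) + (i == survivor b k)
  else 0.

Lemma survivor_le (b : nat -> bool) (k : nat) : survivor b k <= k.-1.
Proof. by elim: k => //= k IH; case: ifP => // _; lia. Qed.

Lemma mult_gt0 (n : nat) (b : nat -> bool) (i j : nat) :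
  0 < mult n b i j -> i < j.
Proof. by case: j => //= k; have := survivor_le b k; case: ifP => _; [case: (b _)|]; lia. Qed.

Lemma sum_ord_recr (F : nat -> nat) (m : nat) :
  \sum_(j < m.+1) F j = \sum_(j < m) F j + F m.
Proof. exact: big_ord_recr. Qed.

(* The out-degree sums telescope, because the edges into k+1 together with the
   survivor after k+1 are the three edges crossing the cut after k. *)
Lemma mult_partial_outdeg (n : nat) (b : nat -> bool) (i m : nat) : m < n ->
  \sum_(j < m.+1) mult n b i j + (i == survivor b m) = 2 * (i < m) + (i == 0).
Proof.
elim: m => [|m IH] lt_mn; first by rewrite sum_ord_recr big_ord0 /=; lia.
have /= {}IH := IH (ltnW lt_mn).
rewrite sum_ord_recr /= lt_mn.
by case: (b m.+1); lia.
Qed.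

Lemma mult_outdeg (n : nat) (b : nat -> bool) (i : nat) : 0 < n ->
  \sum_(j < n.+1) mult n b i j = 2 * (i < n) + (i == 0).
Proof.
case: n => // n _; rewrite sum_ord_recr /= ltnn.
by have /= := mult_partial_outdeg n.+1 b i n (ltnSn n); lia.
Qed.

Lemma sum_ord_eq (n k : nat) : k <= n -> \sum_(i < n.+1) (i == k :> nat) = 1.
Proof.
move=> le_kn; rewrite (bigD1 (Ordinal (le_kn : k < n.+1))) //= eqxx big1 //.
by move=> i; rewrite -val_eqE /= => /negPf ->.
Qed.

Lemma mult_indeg (n : nat) (b : nat -> bool) (j : nat) : 0 < n -> j <= n ->
  \sum_(i < n.+1) mult n b i j = 2 * (0 < j) + (j == n).
Proof.
case: j => [|k] n_gt0 le_kn /=; first by rewrite big1 //; lia.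
have le_sn : survivor b k <= n by have := survivor_le b k; lia.
by case: ltnP => ?; rewrite big_split /= -!big_distrr /= !sum_ord_eq; try lia;
  case: (b k.+1); lia.
Qed.

Lemma sum_ord2 (n : nat) (x : nat -> nat) (p m : nat) : p < m -> m <= n ->
  (forall i, i <= n -> i != m -> i != p -> x i = 0) ->
  \sum_(i < n.+1) x i = x m + x p.
Proof.
move=> lt_pm le_mn x0.
have lt_pn : p < n.+1 by lia.
rewrite (bigD1 (Ordinal (le_mn : m < n.+1))) //= (bigD1 (Ordinal lt_pn)) /=.
  rewrite big1 ?addn0 // => i /andP[]; rewrite -!val_eqE /= => im ip.
  by apply: x0 => //; rewrite -ltnS.
by rewrite -val_eqE /=; lia.
Qed.

(** Induction on the columns: once the earlier ones agree, the out-degrees bound the next column by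
    the multiset of crossing sources, and in-degree 2 leaves only the choice that [b] records. *)
Lemma mult_unique (n : nat) (e : nat -> nat -> nat) (b : nat -> bool) :
  1 < n ->
  (forall i j, i <= n -> j <= n -> 0 < e i j -> i < j) ->
  (forall i, i <= n -> \sum_(j < n.+1) e i j = 2 * (i < n) + (i == 0)) ->
  (forall j, j <= n -> \sum_(i < n.+1) e i j = 2 * (0 < j) + (j == n)) ->
  b 1 = false ->
  (forall k, k.+2 < n -> b k.+2 = (e k.+1 k.+2 != 2)) ->
  forall i j, i <= n -> j <= n -> e i j = mult n b i j.
Proof.
move=> n_gt1 dag out_e in_e b1 bE.
have e_dag i j : i <= n -> j <= n -> j <= i -> e i j = 0.
  by move=> ? ? ?; case: (posnP (e i j)) => // /dag; lia.
suff H m i j : m <= n -> i <= n -> j <= m -> e i j = mult n b i j.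
  by move=> i j; apply: (H n).
elim: m i j => [|m IH] i j le_mn le_in le_jm.
  have -> : j = 0 by lia.
  by rewrite e_dag.
have [/IH -> //|lt_mj] := leqP j m; first by lia.
have {j le_jm lt_mj}-> : j = m.+1 by lia.
(* The telescoped identity passes to [e], since its columns up to [m] agree with [mult]. *)
have sumE i' : i' <= n -> 
    \sum_(k < m.+1) e i' k + (i' == survivor b m) = 2 * (i' < m) + (i' == 0).
  move=> le_i'n; rewrite -(mult_partial_outdeg n b i' m le_mn); congr (_ + _).
  by apply: eq_bigr => k _; apply: IH; rewrite ?(ltnW le_mn) // -ltnS.
have le_out i' : i' <= n ->
    \sum_(k < m.+1) e i' k + e i' m.+1 <= 2 * (i' < n) + (i' == 0).
  move=> le_i'n; rewrite -out_e // -(sum_ord_recr (e i')).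
  rewrite -(subnKC le_mn) -!addSn !big_split_ord /=.
  rewrite -[in X in X <= _](big_mkord xpredT (fun k => e i' k)).
  rewrite -[in X in _ <= X](big_mkord xpredT (fun k => e i' k)).
  exact: leq_addr.
(* In the last column the out-degree of [i] leaves a single possible value. *)
have [lt_mn|ge_mn] := ltnP m.+1 n; last first.
  have eqn : n = m.+1 by lia.
  move: (out_e i le_in) (sumE i le_in) (e_dag i m.+1 le_in le_mn).
  by rewrite sum_ord_recr [mult _ _ _ _]/= eqn ltnn; lia.
(* Column [m.+1] is a submultiset of {survivor, [m], [m]}: [sumE] and [le_out] bound rows up to [m],
   and [e_dag] kills the others. *)
have le_e i' : i' <= n -> e i' m.+1 <= 2 * (i' == m) + (i' == survivor b m).
  move=> le_i'n; have := sumE _ le_i'n; have := le_out _ le_i'n.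
  by have := e_dag i' m.+1 le_i'n le_mn; lia.
have := in_e _ le_mn; rewrite /= lt_mn.
(* Vertex 1 can only be fed by vertex 0, so its in-degree forces multiplicity 2. *)
case: m => [|m] in IH le_mn sumE le_out lt_mn le_e *.
  rewrite b1 big_ord_recl /= big1 => [|k _]; last first.
    by apply/eqP; rewrite -leqn0; apply: leq_trans (le_e _ (ltn_ord k)) _.
  by have := le_e i le_in; case: (eqVneq i 0) => [->|]; lia.
(* Now the two possible sources are distinct. The survivor supplies at most one edge, so
   [e m.+1 m.+2] is 2 or 1, as [bE] records. *)
have lt_sm : survivor b m.+1 < m.+1 by have := survivor_le b m.+1; lia.
have e0 i' : i' <= n -> i' != m.+1 -> i' != survivor b m.+1 -> e i' m.+2 = 0.
  by move=> le_i'n; have := le_e i' le_i'n; lia.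
rewrite (bE _ lt_mn) (sum_ord2 n (fun i => e i m.+2) _ _ lt_sm (ltnW le_mn) e0).
have := le_e m.+1 (ltnW le_mn).
have le_sn : survivor b m.+1 <= n by lia.
have := le_e _ le_sn; have := le_e i le_in.
set s := survivor b m.+1 in lt_sm *.
by case: (eqVneq i m.+1) => [->|_]; [|case: (eqVneq i s) => [->|_]]; lia.
Qed.

Lemma eq_map_enum_ord (n a c d : nat) (f : 'I_n.+1 -> nat) : 0 < n ->
  [seq f i | i <- enum 'I_n.+1] = a :: rcons (nseq n.-1 c) d <->
  forall i : 'I_n.+1, f i = if i == 0 :> nat then a
                            else if i == n :> nat then d else c.
Proof.
move=> n_gt0.
have nthE i : i <= n -> nth 0 (a :: rcons (nseq n.-1 c) d) i =
    if i == 0 then a else if i == n then d else c.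
  case: i => [|i] //= lt_in; rewrite nth_rcons size_nseq nth_nseq.
  by do !case: ifP; lia.
split=> [eqf i|fE].
  rewrite -nthE -1?ltnS // -eqf (nth_map i) ?size_enum_ord //.
  by rewrite nth_ord_enum.
apply: (@eq_from_nth _ 0) => [|i].
  by rewrite size_map size_enum_ord /= size_rcons size_nseq prednK.
rewrite size_map size_enum_ord => lt_in.
rewrite nthE // (nth_map ord0) ?size_enum_ord // fE.
by rewrite nth_enum_ord.
Qed.

Lemma F3P (n : nat) (E : edge_multiset n) : 0 < n ->
  F3 n E <-> [/\ is_dag E,
                 forall i, outdeg E i = 2 * (i < n) + (i == 0 :> nat) &
                 forall j, indeg E j = 2 * (0 < j) + (j == n :> nat)].
Proof.
move=> n_gt0; rewrite /F3 /outdeg_seq /indeg_seq /=.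
split=> -[dagE].
  move=> /(eq_map_enum_ord _ _ _ _ _ n_gt0) outE.
  move=> /(eq_map_enum_ord _ _ _ _ _ n_gt0) inE.
  by split=> // i; rewrite ?outE ?inE; have := ltn_ord i; do !case: ifP; lia.
move=> outE inE.
by split=> //; apply/eq_map_enum_ord => // i; rewrite ?outE ?inE;
  have := ltn_ord i; do !case: ifP; lia.
Qed.

Definition choice_word (n : nat) (E : edge_multiset n) : (n - 2).-tuple 'Z_2 :=
  [tuple ((E (inord i.+1, inord i.+2) != 2)%:R)%R | i < n - 2].

(** Letter [i] belongs to vertex [i + 2]. The guard sets the choice at vertex 1 to false, where
    truncated [j.-2] would reread letter 0. *)
Definition choice_at (n : nat) (t : (n - 2).-tuple 'Z_2) (j : nat) : bool :=
  (1 < j) && (nth 0%R t j.-2 != 0%R).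

Definition mset_of_word (n : nat) (t : (n - 2).-tuple 'Z_2) : edge_multiset n :=
  [fsfun e in [fset e in {: 'I_n.+1 * 'I_n.+1}]%fset =>
     mult n (choice_at n t) e.1 e.2].

Lemma mset_of_wordE (n : nat) (t : (n - 2).-tuple 'Z_2) (i j : 'I_n.+1) :
  mset_of_word n t (i, j) = mult n (choice_at n t) i j.
Proof. by rewrite /mset_of_word fsfunE !inE. Qed.

Lemma Z2_natr_neq0 (z : 'Z_2) : ((z != 0)%:R = z)%R.
Proof. by apply/val_inj; case: z => [[|[|]]]. Qed.

Lemma mset_of_word_F3 (n : nat) (t : (n - 2).-tuple 'Z_2) : 0 < n ->
  F3 n (mset_of_word n t).
Proof.
move=> n_gt0; apply/F3P => //; split=> [i j|i|j].
- by rewrite in_mset mset_of_wordE => /mult_gt0.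
- rewrite -(mult_outdeg n (choice_at n t) i n_gt0).
  by apply: eq_bigr => j _; rewrite mset_of_wordE.
- rewrite -(mult_indeg n (choice_at n t) j n_gt0) -1?ltnS //.
  by apply: eq_bigr => i _; rewrite mset_of_wordE.
Qed.

Lemma mset_of_wordK (n : nat) (t : (n - 2).-tuple 'Z_2) :
  choice_word n (mset_of_word n t) = t.
Proof.
apply/eq_from_tnth => i; rewrite tnth_mktuple mset_of_wordE.
have lt_in := ltn_ord i.
rewrite !inordK; try lia.
rewrite -[RHS]Z2_natr_neq0 (tnth_nth 0%R); congr (nat_of_bool _)%:R%R.
have -> : (nth 0%R t i != 0%R) = choice_at n t i.+2 by [].
(* As the survivor differs from [i.+1], the multiplicity of the edge read is exactly 2 minus the
   choice. *)
have lt_s : survivor (choice_at n t) i.+1 < i.+1.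
  by have := survivor_le (choice_at n t) i.+1; lia.
rewrite /mult (_ : i.+2 < n); last by lia.
by case: (choice_at _ _ _); lia.
Qed.

Lemma choice_wordK (n : nat) (E : edge_multiset n) : 1 < n -> F3 n E ->
  mset_of_word n (choice_word n E) = E.
Proof.
move=> n_gt1 /(F3P _ _ (ltnW n_gt1)) [dagE outE inE].
apply/msetP => -[i j]; rewrite mset_of_wordE; apply/esym.
(* [E] is extended through [inord] to a function of natural numbers, so that [mult_unique]
   applies. *)
rewrite -[in LHS](inord_val i) -[in LHS](inord_val j).
have inordE k : k <= n -> nat_of_ord (inord k : 'I_n.+1) = k by move=> ?; rewrite inordK.
apply: (mult_unique n (fun i j => E (inord i, inord j))) => //;
  rewrite -1?ltnS //.
- by move=> p q le_p le_q; rewrite -in_mset => /dagE; rewrite !inordE.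
- move=> p le_p; rewrite -[in RHS](inordE p) // -outE.
  by apply: eq_bigr => q _; rewrite inord_val.
- move=> q le_q; rewrite -[in RHS](inordE q) // -inE.
  by apply: eq_bigr => p _; rewrite inord_val.
move=> k lt_kn; rewrite /choice_at /=.
have lt_k2 : k < n - 2 by lia.
rewrite -[k in nth _ _ k]/(nat_of_ord (Ordinal lt_k2)).
rewrite -(tnth_nth 0%R (choice_word n E)) tnth_mktuple /=.
by case: (_ == 2).
Qed.

Lemma card_setT_finType (T : finType) : [set: T] #= `I_#|T|.
Proof.
apply/card_esym; have <- : (fun x : T => nat_of_ord (enum_rank x)) @` setT = `I_#|T|.
  apply/seteqP; split=> [_ [x _ <-]|k lt_kT] /=; first exact: ltn_ord.
  by exists (enum_val (Ordinal lt_kT)) => //; rewrite enum_valK.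
by apply: inj_card_eq => x y _ _ /val_inj /enum_rank_inj.
Qed.

Theorem theorem3p4 (n : nat) (hn : 2 <= n) :
  (exists f : edge_multiset n -> (n - 2).-tuple 'Z_2,
     set_bij (F3 n) [set: (n - 2).-tuple 'Z_2] f) /\
  F3 n #= `I_(2 ^ (n - 2)).
Proof.
have bij_word : set_bij (F3 n) [set: (n - 2).-tuple 'Z_2] (choice_word n).
  split=> // [E E' /set_mem FE /set_mem FE' eqw|t _].
    by rewrite -(choice_wordK n E) // eqw choice_wordK.
  by exists (mset_of_word n t); [apply/mset_of_word_F3/ltnW|apply: mset_of_wordK].
split; first by exists (choice_word n).
have -> : 2 ^ (n - 2) = #|{: (n - 2).-tuple 'Z_2}| by rewrite card_tuple card_ord.
apply: card_eq_trans (card_setT_finType _).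
have [_ injw surjw] := bij_word.
(* The cardinality transfers along the injective image of [F3 n], which is the full set of words. *)
have <- : choice_word n @` F3 n = setT by apply/seteqP; split.
exact/card_esym/inj_card_eq.
Qed.
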